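(* Let $X$ and $Y$ be two systems that interact with each other by a recursive logistic interaction (of negative-negative, positive-negative or positive-positive type). A necessary and sufficient condition for system $X$ to fall in a period-$k$ attractor is that system $Y$ also falls in a period-$k$ attractor.
   Context: Two systems $X$ and $Y$ have states described by real sequences $(x_n)_{n\ge 0}$ and $(y_n)_{n\ge 0}$, started from initial seeds $x_0,y_0$ and evolving by coupled logistic recursions $$x_{n+1} = g_x(y_n)\, x_n (1-x_n), \qquad y_{n+1} = g_y(x_n)\, y_n (1-y_n).$$ Here $g_x$ is the interaction function of $X$ with $Y$: $g_x(y_n) = 4(1 - S_x y_n)$ if the interaction of $X$ with $Y$ is negative, and $g_x(y_n) = 4 S_x y_n$ if it is positive. Similarly, $g_y$ is the interaction function of $Y$ with $X$: $g_y(x_n) = 4(1 - S_y x_n)$ if the interaction of $Y$ with $X$ is negative, and $g_y(x_n) = 4 S_y x_n$ if it is positive. The sensitivities $S_x, S_y$ are real numbers in $(0,1]$. The three types of recursive logistic interaction are: (1) Negative-negative: $x_{n+1} = 4(1 - S_x y_n) x_n (1-x_n)$, $y_{n+1} = 4(1 - S_y x_n) y_n (1-y_n)$. (2) Positive-negative: $x_{n+1} = 4 S_x y_n x_n (1-x_n)$, $y_{n+1} = 4(1 - S_y x_n) y_n (1-y_n)$. (3) Positive-positive: $x_{n+1} = 4 S_x y_n x_n (1-x_n)$, $y_{n+1} = 4 S_y x_n y_n (1-y_n)$. System $X$ falls in a period-$k$ attractor ($k$ a positive integer) if there is an integer $i > 0$ such that $x_n = x_{n+k}$ for all $n > i$.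 Likewise, system $Y$ falls in a period-$k$ attractor if there is an integer $i > 0$ such that $y_n = y_{n+k}$ for all $n > i$.
   Formalization: The seeds are assumed to lie in (0,1), or else it must not happen that exactly one of the systems X, Y reaches the state 0; without this the claim fails, e.g. negative-negative with x_0=0, y_0=2, where X is constant and Y decreases to minus infinity. *)

(* Defs.v *)
(* Stdlib world: the concrete real numbers R. *)
From Stdlib Require Import Reals.
Open Scope R_scope.

Inductive sign : Set := Negative | Positive.

(* The interaction function of a system of sensitivity [s] whose partner is
   in state [z]. *)
Definition interaction_function (sg : sign) (s z : R) : R :=
  match sg with
  | Negative => 4 * (1 - s * z)
  | Positive => 4 * s * z
  end.

Inductive interaction_type : Set :=
  | NegativeNegative
  | PositiveNegative
  | PositivePositive.

Definition sign_x (t : interaction_type) : sign :=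
  match t with
  | NegativeNegative => Negative
  | PositiveNegative | PositivePositive => Positive
  end.

Definition sign_y (t : interaction_type) : sign :=
  match t with
  | NegativeNegative | PositiveNegative => Negative
  | PositivePositive => Positive
  end.

(* The seeds are [x 0] and [y 0]; they determine both sequences. *)
Definition recursive_logistic_interaction
    (t : interaction_type) (Sx Sy : R) (x y : nat -> R) : Prop :=
  forall n : nat,
    x (S n) = interaction_function (sign_x t) Sx (y n) * x n * (1 - x n) /\
    y (S n) = interaction_function (sign_y t) Sy (x n) * y n * (1 - y n).

(* [k] is a period, not necessarily the least one. *)
Definition falls_in_period_attractor (k : nat) (u : nat -> R) : Prop :=
  exists i : nat, (0 < i)%nat /\
    forall n : nat, (i < n)%nat -> u n = u (n + k)%nat.

(* A state that reaches 0 stays there for ever. *)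
Definition dies_out (u : nat -> R) : Prop := exists n : nat, u n = 0.

(* The seeds lie in the open unit interval, the usual domain of the logistic
   map, or else they are arbitrary reals for which it does not happen that one
   system dies out while the other one survives.  In the excluded case the
   dead system is constant, hence periodic, but no longer constrains the
   survivor, which may follow z |-> 4 z (1 - z) without ever being periodic;
   an example is x 0 = 0, y 0 = 2 with both interactions negative. *)
Definition nondegenerate (x y : nat -> R) : Prop :=
  (0 < x 0%nat < 1 /\ 0 < y 0%nat < 1) \/ (dies_out x <-> dies_out y).

(* Main.v *)
Require Import Defs.
From Stdlib Require Import Reals.
From Stdlib Require Import Lra Lia Classical.
Open Scope R_scope.

(** A period passes from one system to the other because the recursion can be
    solved for the partner: as long as [u n * (1 - u n)] does not vanish, the
    quotient [u (S n) / (u n * (1 - u n))] is the value of the interaction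
    function at the partner's state, and the interaction function is affine
    with nonzero slope, hence injective.  So the pair [u n], [u (S n)]
    determines the partner's state at time [n], and the partner inherits every
    period of [u], from the same time on ([period_passes_to_partner]).

    The factor [u n * (1 - u n)] vanishes only if [u n = 0] or [u n = 1], and
    in the latter case [u (S n) = 0]; so the argument applies to every system
    that does not die out.  A system that dies out is eventually constant
    ([dies_out_periodic]), which settles the case where both die.  The mixed
    case, one dead and one surviving, cannot occur for seeds in the open unit
    interval: there both interaction functions take values strictly between 0
    and 4, and a logistic map of such a parameter preserves the open interval
    ([unit_interval_invariant]), so neither system dies.

    The three interaction types need no separate treatment, since all of this
    concerns one recursion at a time, for either sign of the interaction. *)

(** One half of the coupled recursion, with no constraint on the partner [v];
    both systems satisfy it, with the roles exchanged. *)
Definition driven_by (sg : sign) (s : R) (u v : nat -> R) : Prop :=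
  forall n : nat,
    u (S n) = interaction_function sg s (v n) * u n * (1 - u n).

Lemma interaction_function_injective (sg : sign) (s a b : R) :
  s <> 0 ->
  interaction_function sg s a = interaction_function sg s b -> a = b.
Proof.
  intros Hs H. apply (Rmult_eq_reg_l s); [| exact Hs].
  destruct sg; simpl in H; lra.
Qed.

Lemma zero_absorbing (sg : sign) (s : R) (u v : nat -> R) (m n : nat) :
  driven_by sg s u v -> u m = 0 -> (m <= n)%nat -> u n = 0.
Proof.
  intros Hu H0 Hmn. induction Hmn as [| n _ IH]; [exact H0 |].
  rewrite (Hu n), IH. ring.
Qed.

Lemma dies_out_periodic (sg : sign) (s : R) (u v : nat -> R) (k : nat) :
  driven_by sg s u v -> dies_out u -> falls_in_period_attractor k u.
Proof.
  intros Hu [m Hm].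
  (* The successor makes the threshold positive even if the seed is 0. *)
  exists (S m). split; [lia |]. intros n Hn.
  rewrite (zero_absorbing sg s u v m n), (zero_absorbing sg s u v m (n + k));
    auto; lia.
Qed.

(** The state 1 is excluded as well as 0, because its successor is 0. *)
Lemma survivor_factor_neq0 (sg : sign) (s : R) (u v : nat -> R) (n : nat) :
  driven_by sg s u v -> ~ dies_out u -> u n * (1 - u n) <> 0.
Proof.
  intros Hu Halive H. apply Halive. exists (S n).
  rewrite (Hu n), Rmult_assoc, H. ring.
Qed.

(** The recursion of the periodic system, at the times [n] and [n + k], has
    the same left-hand side and the same nonzero factor [u n * (1 - u n)];
    cancelling it leaves equal interaction values, hence equal partner
    states. *)
Lemma period_passes_to_partner (sg : sign) (s : R) (u v : nat -> R) (k : nat) :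
  s <> 0 -> driven_by sg s u v -> ~ dies_out u ->
  falls_in_period_attractor k u -> falls_in_period_attractor k v.
Proof.
  intros Hs Hu Halive [i [Hi Hper]]. exists i. split; [exact Hi |].
  intros n Hn. apply (interaction_function_injective sg s _ _ Hs).
  apply (Rmult_eq_reg_r (u n * (1 - u n))).
  - assert (Hnext : u (S n) = u (S (n + k))) by (apply (Hper (S n)); lia).
    rewrite (Hu n), (Hu (n + k)%nat), <- (Hper n Hn) in Hnext.
    rewrite <- !Rmult_assoc. exact Hnext.
  - exact (survivor_factor_neq0 sg s u v n Hu Halive).
Qed.

Lemma interaction_function_range (sg : sign) (s z : R) :
  0 < s <= 1 -> 0 < z < 1 -> 0 < interaction_function sg s z < 4.
Proof.
  intros Hs Hz. assert (0 < s * z < 1) by nra.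
  destruct sg; simpl; lra.
Qed.

(** The upper bound is strict because [z * (1 - z) <= 1 / 4] and [g < 4]; for
    [g = 4] the point [z = 1 / 2] would be sent to 1 and then to 0. *)
Lemma logistic_map_range (g z : R) :
  0 < g < 4 -> 0 < z < 1 -> 0 < g * z * (1 - z) < 1.
Proof.
  intros Hg Hz.
  assert (Hpos : 0 < z * (1 - z)) by nra.
  assert (Hmax : z * (1 - z) <= 1 / 4)
    by (pose proof (Rle_0_sqr (z - 1 / 2)); unfold Rsqr in *; lra).
  rewrite Rmult_assoc.
  split; [apply Rmult_lt_0_compat; lra | nra].
Qed.

(** The induction has to carry both systems at once: the interval is invariant
    for one of them only while the other one stays in it. *)
Lemma unit_interval_invariant
    (sgu sgv : sign) (su sv : R) (u v : nat -> R) (n : nat) :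
  0 < su <= 1 -> 0 < sv <= 1 ->
  driven_by sgu su u v -> driven_by sgv sv v u ->
  0 < u 0%nat < 1 -> 0 < v 0%nat < 1 ->
  0 < u n < 1 /\ 0 < v n < 1.
Proof.
  intros Hsu Hsv Hu Hv Hu0 Hv0.
  induction n as [| n [IHu IHv]]; [now split |].
  rewrite (Hu n), (Hv n).
  split; apply logistic_map_range; auto using interaction_function_range.
Qed.

Lemma nondegenerate_dies_out_iff
    (sgx sgy : sign) (sx sy : R) (x y : nat -> R) :
  0 < sx <= 1 -> 0 < sy <= 1 ->
  driven_by sgx sx x y -> driven_by sgy sy y x ->
  nondegenerate x y -> (dies_out x <-> dies_out y).
Proof.
  intros Hsx Hsy Hx Hy [[Hx0 Hy0] | Hiff]; [| exact Hiff].
  pose proof (fun n =>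
    unit_interval_invariant sgx sgy sx sy x y n Hsx Hsy Hx Hy Hx0 Hy0) as Hin.
  split; intros [n Hn]; specialize (Hin n); lra.
Qed.

Theorem theorem1 (t : interaction_type) (Sx Sy : R) (x y : nat -> R) (k : nat)
    (hSx : 0 < Sx <= 1) (hSy : 0 < Sy <= 1)
    (hxy : recursive_logistic_interaction t Sx Sy x y)
    (hnd : nondegenerate x y)
    (hk : (0 < k)%nat) :
  falls_in_period_attractor k x <-> falls_in_period_attractor k y.
Proof.
  assert (Hx : driven_by (sign_x t) Sx x y) by (intro n; apply (hxy n)).
  assert (Hy : driven_by (sign_y t) Sy y x) by (intro n; apply (hxy n)).
  assert (Hdie : dies_out x <-> dies_out y)
    by exact (nondegenerate_dies_out_iff _ _ _ _ x y hSx hSy Hx Hy hnd).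
  destruct (classic (dies_out x)) as [Hdx | Hax].
  - assert (Hdy : dies_out y) by now apply Hdie.
    split; intros _; eapply dies_out_periodic; eassumption.
  - assert (Hay : ~ dies_out y) by (rewrite <- Hdie; exact Hax).
    split.
    + apply (period_passes_to_partner (sign_x t) Sx); auto; lra.
    + apply (period_passes_to_partner (sign_y t) Sy); auto; lra.
Qed.
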